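(* Let $A$ be a commutative ring and $n\ge0$ an integer. (1) If $a,b_1,\dots,b_n\in A$ and $\mathrm{Hdim}(A[a^{-1}])<n$, then there exist $x_1,\dots,x_n\in A$ such that $\mathrm{D}_A(a,b_1,\dots,b_n)=\mathrm{D}_A(b_1+ax_1,\dots,b_n+ax_n)$. (2) Consequently, if $a_1,\dots,a_r,b_1,\dots,b_n\in A$ and $\mathrm{Hdim}(A[a_i^{-1}])<n$ for $1\le i\le r$, then there exist $y_1,\dots,y_n\in\langle a_1,\dots,a_r\rangle$ such that $$\mathrm{D}_A(a_1,\dots,a_r,b_1,\dots,b_n)=\mathrm{D}_A(b_1+y_1,\dots,b_n+y_n).$$
   Context: $\mathrm{D}_A(y_1,\dots,y_m)=\sqrt{\langle y_1,\dots,y_m\rangle}$ denotes the radical of the ideal of $A$ generated by $y_1,\dots,y_m$. $A[a^{-1}]$ is the localization of $A$ at the powers of $a$. For a commutative ring $B$, let $\mathrm{J}_B(0)=\{x\in B:\forall y\in B,\ 1+xy \text{ is invertible}\}$ be its Jacobson radical, and for $x\in B$ let $\mathrm{H}_B(x)=xB+(\mathrm{J}_B(0):x)$ (Heitmann boundary ideal), where $(\mathrm{J}_B(0):x)=\{b\in B: bx\in \mathrm{J}_B(0)\}$. The Heitmann dimension is defined inductively: $\mathrm{Hdim}\,B\le -1$ iff $1=0$ in $B$; for $\ell\ge 0$, $\mathrm{Hdim}\,B\le \ell$ iff $\mathrm{Hdim}(B/\mathrm{H}_B(x))\le\ell-1$ for all $x\in B$. $\mathrm{Hdim}\,B<n$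 means $\mathrm{Hdim}\,B\le n-1$. *)

(* Defs.v *)
From HB Require Import structures.
From mathcomp Require Import all_boot all_algebra ring.
From mathcomp Require Import boolp classical_sets.

Set Implicit Arguments.
Unset Strict Implicit.
Unset Printing Implicit Defensive.

Import GRing.Theory.
Local Open Scope ring_scope.
Local Open Scope quotient_scope.
Local Open Scope classical_set_scope.

(* Rings are [comPzRingType]s, so the zero ring is allowed: quotients by the
   unit ideal and localizations at a nilpotent element do occur below. *)

Section Ideals.
Variable B : comPzRingType.

Definition is_ideal (I : set B) : Prop :=
  [/\ I 0, forall x y, I x -> I y -> I (x + y)
    & forall c x, I x -> I (c * x)].

Record ideal := Ideal { ideal_set :> B -> Prop; idealP : is_ideal ideal_set }.

Definition ideal_gen (s : seq B) : set B :=
  [set z | exists c : 'I_(size s) -> B, z = \sum_(i < size s) c i * s`_i].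

Definition radical (I : set B) : set B := [set x | exists k, I (x ^+ k)].

Definition D (s : seq B) : set B := radical (ideal_gen s).

Definition invertible (u : B) : Prop := exists v, u * v = 1.

End Ideals.

(* The quotients {ideal_quot I} of the library only have a ring structure for
   proper ideals, so the multiplication on [Quotient.quot] is redone here. *)
Section RingQuotient.
Variables (B : comPzRingType) (I : ideal B).

Definition ideal_mem : {pred B} := fun x => `[< I x >].

Fact ideal_mem_zmod_closed : zmod_closed ideal_mem.
Proof.
have [I0 ID IM] := idealP I; split=> [|x y /asboolP Ix /asboolP Iy].
  exact/asboolP.
by apply/asboolP/ID => //; rewrite -mulN1r; exact: IM.
Qed.

HB.instance Definition _ :=
  GRing.isZmodClosed.Build B ideal_mem ideal_mem_zmod_closed.

Definition ring_quot : Type := Quotient.quot ideal_mem.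

HB.instance Definition _ :=
  ZmodQuotient.copy ring_quot (Quotient.quot ideal_mem).

Definition quot_mul := lift_op2 ring_quot *%R.

Fact ring_quotE (x y : B) :
  (\pi_ring_quot x == \pi_ring_quot y) = `[< I (x - y) >].
Proof. by rewrite -(Quotient.idealrBE ideal_mem). Qed.

Fact pi_quot_mul : {morph \pi_ring_quot : x y / x * y >-> quot_mul x y}.
Proof.
have [_ ID IM] := idealP I.
move=> x y; unlock quot_mul; apply/eqP; rewrite ring_quotE; apply/asboolP.
set x' := repr _; set y' := repr _.
have Ix : I (x - x') by apply/asboolP; rewrite -ring_quotE reprK.
have Iy : I (y - y') by apply/asboolP; rewrite -ring_quotE reprK.
have -> : x * y - x' * y' = y * (x - x') + x' * (y - y').
  by rewrite !mulrBr addrA ![y * _]mulrC subrK.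
by apply: ID; exact: IM.
Qed.

Fact quot_mulA : associative quot_mul.
Proof.
by elim/quotW=> x; elim/quotW=> y; elim/quotW=> z; rewrite -!pi_quot_mul mulrA.
Qed.

Fact quot_mulC : commutative quot_mul.
Proof. by elim/quotW=> x; elim/quotW=> y; rewrite -!pi_quot_mul mulrC. Qed.

Fact quot_mul1 : left_id (\pi_ring_quot 1) quot_mul.
Proof. by elim/quotW=> x; rewrite -pi_quot_mul mul1r. Qed.

Fact quot_mulDl : left_distributive quot_mul +%R.
Proof.
elim/quotW=> x; elim/quotW=> y; elim/quotW=> z.
have piD u v : \pi_ring_quot (u + v) = \pi_ring_quot u + \pi_ring_quot v.
  exact: pi_addr.
by rewrite -piD -!pi_quot_mul mulrDl piD.
Qed.

HB.instance Definition _ := GRing.Zmodule_isComPzRing.Build ring_quot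
  quot_mulA quot_mulC quot_mul1 quot_mulDl.

End RingQuotient.

(* The localization of A at the powers of a: the pair (x, k) stands for the
   fraction x / a ^+ k. *)
Section Localization.
Variables (A : comPzRingType) (a : A).

Definition loc_equiv (u v : A * nat) : bool :=
  `[< exists m, a ^+ m * (u.1 * a ^+ v.2 - v.1 * a ^+ u.2) = 0 >].

Fact loc_equivP (u v : A * nat) :
  reflect (exists m, a ^+ m * (u.1 * a ^+ v.2) = a ^+ m * (v.1 * a ^+ u.2))
          (loc_equiv u v).
Proof.
apply: (iffP (asboolP _)) => -[m].
  by rewrite mulrBr => /subr0_eq ?; exists m.
by move=> e; exists m; rewrite mulrBr e subrr.
Qed.

Fact loc_equiv_class : equiv_class_of loc_equiv.
Proof.
split=> [u|u v|v u w].
- by apply/loc_equivP; exists 0%N.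
- by apply/loc_equivP/loc_equivP => -[m e]; exists m.
- move=> /loc_equivP[m e1] /loc_equivP[n e2].
  apply/loc_equivP; exists (m + n + v.2)%N; rewrite !exprD.
  have -> : a ^+ m * a ^+ n * a ^+ v.2 * (u.1 * a ^+ w.2)
          = a ^+ m * (u.1 * a ^+ v.2) * (a ^+ n * a ^+ w.2) by ring.
  rewrite e1.
  have -> : a ^+ m * (v.1 * a ^+ u.2) * (a ^+ n * a ^+ w.2)
          = a ^+ n * (v.1 * a ^+ w.2) * (a ^+ m * a ^+ u.2) by ring.
  by rewrite e2; ring.
Qed.

Canonical loc_equiv_equiv := EquivRelPack loc_equiv_class.
Canonical loc_equiv_encModRel := defaultEncModRel loc_equiv.

Definition loc : Type := {eq_quot loc_equiv}.

HB.instance Definition _ := EqQuotient.copy loc {eq_quot loc_equiv}.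
HB.instance Definition _ := Choice.copy loc {eq_quot loc_equiv}.

Definition loc_add0 (u v : A * nat) : A * nat :=
  (u.1 * a ^+ v.2 + v.1 * a ^+ u.2, (u.2 + v.2)%N).
Definition loc_opp0 (u : A * nat) : A * nat := (- u.1, u.2).
Definition loc_mul0 (u v : A * nat) : A * nat := (u.1 * v.1, (u.2 + v.2)%N).

Definition loc_add := lift_op2 loc loc_add0.
Definition loc_opp := lift_op1 loc loc_opp0.
Definition loc_mul := lift_op2 loc loc_mul0.

Fact loc_eqP (u v : A * nat) :
  reflect (exists m, a ^+ m * (u.1 * a ^+ v.2) = a ^+ m * (v.1 * a ^+ u.2))
          (\pi_loc u == \pi_loc v).
Proof. by rewrite eqmodE; exact: loc_equivP. Qed.

Fact pi_loc_add : {morph \pi_loc : u v / loc_add0 u v >-> loc_add u v}.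
Proof.
move=> u v; unlock loc_add; apply/eqP/loc_eqP.
set u' := repr _; set v' := repr _; rewrite /loc_add0 /=.
have /eqP/loc_eqP[m e1] : \pi_loc u = \pi_loc u' by rewrite reprK.
have /eqP/loc_eqP[n e2] : \pi_loc v = \pi_loc v' by rewrite reprK.
exists (m + n)%N; rewrite !exprD.
transitivity (a ^+ m * (u.1 * a ^+ u'.2) * (a ^+ n * a ^+ v.2 * a ^+ v'.2)
  + a ^+ n * (v.1 * a ^+ v'.2) * (a ^+ m * a ^+ u.2 * a ^+ u'.2)); first by ring.
by rewrite e1 e2; ring.
Qed.

Fact pi_loc_opp : {morph \pi_loc : u / loc_opp0 u >-> loc_opp u}.
Proof.
move=> u; unlock loc_opp; apply/eqP/loc_eqP.
set u' := repr _; rewrite /loc_opp0 /=.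
have /eqP/loc_eqP[m e1] : \pi_loc u = \pi_loc u' by rewrite reprK.
by exists m; rewrite !mulNr !mulrN e1.
Qed.

Fact pi_loc_mul : {morph \pi_loc : u v / loc_mul0 u v >-> loc_mul u v}.
Proof.
move=> u v; unlock loc_mul; apply/eqP/loc_eqP.
set u' := repr _; set v' := repr _; rewrite /loc_mul0 /=.
have /eqP/loc_eqP[m e1] : \pi_loc u = \pi_loc u' by rewrite reprK.
have /eqP/loc_eqP[n e2] : \pi_loc v = \pi_loc v' by rewrite reprK.
exists (m + n)%N; rewrite !exprD.
transitivity (a ^+ m * (u.1 * a ^+ u'.2) * (a ^+ n * (v.1 * a ^+ v'.2))).
  by ring.
by rewrite e1 e2; ring.
Qed.

Fact loc_eq (u v : A * nat) :
  u.1 * a ^+ v.2 = v.1 * a ^+ u.2 -> \pi_loc u = \pi_loc v.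
Proof. by move=> e; apply/eqP/loc_eqP; exists 0%N; rewrite e. Qed.

Fact loc_addA : associative loc_add.
Proof.
elim/quotW=> u; elim/quotW=> v; elim/quotW=> w; rewrite -!pi_loc_add.
by apply: loc_eq; rewrite /loc_add0 /= !exprD; ring.
Qed.

Fact loc_addC : commutative loc_add.
Proof.
elim/quotW=> u; elim/quotW=> v; rewrite -!pi_loc_add.
by apply: loc_eq; rewrite /loc_add0 /= !exprD; ring.
Qed.

Fact loc_add0l : left_id (\pi_loc (0, 0%N)) loc_add.
Proof.
elim/quotW=> u; rewrite -!pi_loc_add.
by apply: loc_eq; rewrite /loc_add0 /= add0n; ring.
Qed.

Fact loc_addNl : left_inverse (\pi_loc (0, 0%N)) loc_opp loc_add.
Proof.
elim/quotW=> u; rewrite -pi_loc_opp -!pi_loc_add.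
by apply: loc_eq; rewrite /loc_add0 /loc_opp0 /=; ring.
Qed.

HB.instance Definition _ :=
  GRing.isZmodule.Build loc loc_addA loc_addC loc_add0l loc_addNl.

Fact loc_mulA : associative loc_mul.
Proof.
elim/quotW=> u; elim/quotW=> v; elim/quotW=> w; rewrite -!pi_loc_mul.
by apply: loc_eq; rewrite /loc_mul0 /= !exprD; ring.
Qed.

Fact loc_mulC : commutative loc_mul.
Proof.
elim/quotW=> u; elim/quotW=> v; rewrite -!pi_loc_mul.
by apply: loc_eq; rewrite /loc_mul0 /= !exprD; ring.
Qed.

Fact loc_mul1l : left_id (\pi_loc (1, 0%N)) loc_mul.
Proof.
elim/quotW=> u; rewrite -!pi_loc_mul.
by apply: loc_eq; rewrite /loc_mul0 /= add0n; ring.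
Qed.

Fact loc_mulDl : left_distributive loc_mul loc_add.
Proof.
elim/quotW=> u; elim/quotW=> v; elim/quotW=> w.
rewrite -pi_loc_add -!pi_loc_mul -pi_loc_add.
by apply: loc_eq; rewrite /loc_add0 /loc_mul0 /= !exprD; ring.
Qed.

HB.instance Definition _ := GRing.Zmodule_isComPzRing.Build loc
  loc_mulA loc_mulC loc_mul1l loc_mulDl.

End Localization.

Section HeitmannBoundary.
Variable B : comPzRingType.

Definition jacobson : set B := [set x | forall y, invertible (1 + x * y)].

(* The boundary ideal xB + (J : x), with J the Jacobson radical. *)
Definition heitmann_set (x : B) : set B :=
  [set z | exists c b, jacobson (b * x) /\ z = x * c + b].

Fact jacobson_ideal : is_ideal jacobson.
Proof.
split=> [y|x y Jx Jy z|c x Jx y].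
- by exists 1; rewrite mul0r addr0 mulr1.
- have [u xu] := Jx z; have [v yv] := Jy (z * u).
  exists (u * v).
  transitivity (((1 + x * z) * u + y * (z * u)) * v); first by ring.
  by rewrite xu.
- by rewrite [c * x]mulrC -mulrA; exact: Jx.
Qed.

Fact heitmann_ideal (x : B) : is_ideal (heitmann_set x).
Proof.
have [J0 JD JM] := jacobson_ideal; split.
- by exists 0, 0; rewrite mul0r mulr0 addr0.
- move=> _ _ [c [b [Jb ->]]] [d [e [Je ->]]]; exists (c + d), (b + e).
  by split; [rewrite mulrDl; exact: JD | ring].
- move=> d _ [c [b [Jb ->]]]; exists (d * c), (d * b).
  by split; [rewrite -mulrA; exact: JM | ring].
Qed.

Definition heitmann (x : B) : ideal B := Ideal (heitmann_ideal x).

End HeitmannBoundary.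

(* [Hdim_lt n B] means Hdim B < n, that is, Hdim B <= n - 1; the shift by one
   makes the base case Hdim B <= -1 the case n = 0. *)
Fixpoint Hdim_lt (n : nat) (B : comPzRingType) : Prop :=
  if n is m.+1 then forall x : B, Hdim_lt m (ring_quot (heitmann x))
  else 1 = 0 :> B.

(* Main.v *)
From HB Require Import structures.
Require Import Defs.
From mathcomp Require Import all_boot all_algebra.
From mathcomp Require Import ring.
From mathcomp Require Import boolp classical_sets.

Import GRing.Theory.
Local Open Scope ring_scope.

(** The first claim amounts to [a] being in the radical of the ideal of the
    moved entries [b_i + a * x_i], that is, to these entries generating the unit
    ideal once [a] is inverted ([D_translate]). Such [x_i] are found by
    induction on the dimension ([unimodular_translate]): modulo the boundary
    ideal of the image [s] of one of the [b_i], the other entries can be moved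
    so as to be unimodular. Before passing to the quotient this says that,
    together with [s] and some [p] such that [s * p] is in the Jacobson radical,
    they generate 1. Scaled by a power of [a], this [p] comes from a multiple
    of [a], and two elements [s], [p] with product in the Jacobson radical can
    be replaced by the single element [s + p] ([ideal1_jacobson]).

    The second claim follows by absorbing the [a_i] one at a time: after the
    first claim has moved [b] by multiples of [a_1], the radical is that of
    [a_2, ..., a_r] and the new [b]. *)

(** * Generated ideals and their radicals *)

Section IdealTheory.
Context {B : comPzRingType}.
Implicit Types (I : set B) (s t : seq B).

Lemma ideal_sum I (n : nat) (F : 'I_n -> B) :
  is_ideal I -> (forall i, I (F i)) -> I (\sum_(i < n) F i).
Proof. by case=> I0 ID _ IF; apply: big_ind => // i _; apply: IF. Qed.

Lemma ideal_gen_ideal s : is_ideal (ideal_gen s).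
Proof.
split.
- by exists (fun _ => 0); rewrite big1 // => i _; rewrite mul0r.
- move=> _ _ [c ->] [d ->]; exists (fun i => c i + d i).
  by rewrite -big_split; apply: eq_bigr => i _; rewrite mulrDl.
- move=> e _ [c ->]; exists (fun i => e * c i).
  by rewrite mulr_sumr; apply: eq_bigr => i _; rewrite mulrA.
Qed.

Lemma mem_ideal_gen s z : z \in s -> ideal_gen s z.
Proof.
move=> sz; have lt_z : (index z s < size s)%N by rewrite index_mem.
exists (fun i => (i == Ordinal lt_z)%:R).
rewrite (bigD1 (Ordinal lt_z)) //= eqxx mul1r nth_index // big1 ?addr0 // => i.
by move=> /negPf ->; rewrite mul0r.
Qed.

Lemma ideal_gen_min I s z :
  is_ideal I -> (forall w, w \in s -> I w) -> ideal_gen s z -> I z.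
Proof.
move=> idI sI [c ->]; apply: ideal_sum => // i.
by case: idI => _ _; apply; apply/sI/mem_nth.
Qed.

(** In the binomial expansion of [(x + y) ^+ (j + k)] each term is a multiple
    of [x ^+ j] or of [y ^+ k]. *)
Lemma radical_ideal I : is_ideal I -> is_ideal (radical I).
Proof.
move=> idI; have [I0 _ IM] := idI; split.
- by exists 1%N; rewrite expr1.
- move=> x y [j xj] [k yk]; exists (j + k)%N; rewrite exprDn.
  apply: ideal_sum => // i; rewrite -mulr_natl; apply: (IM).
  case: (leqP k i) => [le_ki | /ltnW lt_ik].
    by rewrite -(subnK le_ki) exprD mulrA; apply: IM.
  have le_j : (j <= j + k - i)%N by rewrite -addnBA // leq_addr.
  by rewrite mulrC -(subnK le_j) exprD mulrA; apply: IM.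
- by move=> c x [k xk]; exists k; rewrite exprMn; apply: IM.
Qed.

Lemma D_ideal s : is_ideal (D s).
Proof. exact/radical_ideal/ideal_gen_ideal. Qed.

Lemma ideal_gen_D s z : ideal_gen s z -> D s z.
Proof. by exists 1%N; rewrite expr1. Qed.

Lemma mem_D s z : z \in s -> D s z.
Proof. by move=> sz; apply/ideal_gen_D/mem_ideal_gen. Qed.

Lemma D_le s t : (forall z, z \in s -> D t z) -> forall z, D s z -> D t z.
Proof.
move=> st z [k] /(ideal_gen_min _ _ _ (D_ideal t) st)[l].
by rewrite -exprM => tz; exists (k * l)%N.
Qed.

Lemma D_eq s t :
  (forall z, z \in s -> D t z) -> (forall z, z \in t -> D s z) -> D s = D t.
Proof. by move=> st ts; apply/seteqP; split=> z; apply: D_le. Qed.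

(** Modulo [K] we have [p = - s], so that squaring [s * u + p * v = 1] gives
    [1 + s * p * (u - v) ^+ 2 = 0]; the left-hand side is a unit. *)
Lemma ideal1_jacobson {K : set B} {s p : B} (u v : B) :
    is_ideal K -> jacobson (s * p) -> K (s + p) -> K (1 - (s * u + p * v)) ->
  K 1.
Proof.
case=> _ KD KM Jsp Ksp K1; have [w <-] := Jsp ((u - v) ^+ 2).
rewrite mulrC; apply: (KM).
have -> : 1 + s * p * (u - v) ^+ 2 =
    (1 + (s * u + p * v)) * (1 - (s * u + p * v)) +
    (s * u ^+ 2 + p * v ^+ 2) * (s + p) by ring.
by apply: KD; apply: (KM).
Qed.

End IdealTheory.

(** * The projection onto a quotient and the map to a localization *)

Section QuotientMap.
Context {B : comPzRingType} (I : ideal B).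

Definition quot_map (x : B) : ring_quot I := \pi_(ring_quot I)%qT x.

Fact quot_map_zmod : zmod_morphism quot_map.
Proof. by move=> x y; rewrite /quot_map pi_addr pi_oppr. Qed.

Fact quot_map_monoid : monoid_morphism quot_map.
Proof. by split=> // x y; apply: pi_quot_mul. Qed.

HB.instance Definition _ := GRing.isZmodMorphism.Build B (ring_quot I)
  quot_map quot_map_zmod.
HB.instance Definition _ := GRing.isMonoidMorphism.Build B (ring_quot I)
  quot_map quot_map_monoid.

Lemma quot_map_eq x y : quot_map x = quot_map y -> I (x - y).
Proof. by move/eqP; rewrite ring_quotE => /asboolP. Qed.

Lemma quot_map_surj z : exists x, z = quot_map x.
Proof. by elim/quotW: z => x; exists x. Qed.

End QuotientMap.

Section LocalizationMap.
Context {A : comPzRingType} (a : A).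

Definition loc_map (x : A) : loc a := \pi_(loc a)%qT (x, 0%N).

Fact loc_map_zmod : zmod_morphism loc_map.
Proof.
move=> x y; rewrite /loc_map.
transitivity (loc_add (\pi_(loc a)%qT (x, 0%N))
                      (loc_opp (\pi_(loc a)%qT (y, 0%N)))); last by [].
rewrite -pi_loc_opp -pi_loc_add; apply: loc_eq.
by rewrite /loc_add0 /loc_opp0 /= expr0 !mulr1.
Qed.

Fact loc_map_monoid : monoid_morphism loc_map.
Proof. by split=> // x y; apply: (pi_loc_mul a (x, 0%N) (y, 0%N)). Qed.

HB.instance Definition _ := GRing.isZmodMorphism.Build A (loc a)
  loc_map loc_map_zmod.
HB.instance Definition _ := GRing.isMonoidMorphism.Build A (loc a)
  loc_map loc_map_monoid.

Lemma loc_map_eq x y :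
  loc_map x = loc_map y -> exists m, a ^+ m * x = a ^+ m * y.
Proof. by move/eqP/loc_eqP => [m]; rewrite /= !mulr1; exists m. Qed.

Lemma loc_map_invertible : invertible (loc_map a).
Proof.
exists (\pi_(loc a)%qT (1, 1%N)); have <- : loc_map 1 = 1 by rewrite rmorph1.
apply: etrans (esym (pi_loc_mul a (a, 0%N) (1, 1%N))) _.
by apply: loc_eq; rewrite /= expr0 !mulr1 mul1r expr1.
Qed.

Lemma loc_map_clear_denom z : exists k x, loc_map a ^+ k * z = loc_map x.
Proof.
elim/quotW: z => -[x k]; exists k, x.
have -> : loc_map a ^+ k = loc_map (a ^+ k) by rewrite rmorphXn.
apply: etrans (esym (pi_loc_mul a (a ^+ k, 0%N) (x, k))) _; apply: loc_eq.
by rewrite /= expr0 mulr1 mulrC.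
Qed.

End LocalizationMap.

(** * Moving a vector inside its class modulo [a] *)

(** The conclusion says that the entries generate the unit ideal, in a form that
    can be applied to an ideal of a quotient of [B] without lifting
    coefficients. The ring [B] is any ring of fractions over the image of
    [A] with powers of [a] as denominators, not the localization itself, because
    the induction passes to quotients of [B]. In the step, let [s] be the image of the
    first entry. In the quotient by the boundary ideal of [s], the other
    entries can be moved so as to generate 1; then in [B] they generate 1
    together with [s] and some [p] with [s * p] in the Jacobson radical. Such a
    [p] may be multiplied by a unit, so it may be taken in the image of
    [a * A], and [s + p] replaces the pair [s], [p]. *)
Lemma unimodular_translate {n : nat} {A B : comPzRingType}
    (phi : {rmorphism A -> B}) (a : A) (b : n.-tuple A) :
    invertible (phi a) ->
    (forall z, exists k x, phi a ^+ k * z = phi x) ->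
    Hdim_lt n B ->
  exists x : n.-tuple A, forall K : set B, is_ideal K ->
    (forall i, K (phi (tnth b i + a * tnth x i))) -> K 1.
Proof.
elim: n B phi b => [|n IHn] B phi b inv_a denom dimB.
  by exists [tuple] => K [K0 _ _] _; rewrite [1]dimB.
have [v av1] := inv_a; case/tupleP: b => b0 b.
set s := phi b0.
pose pi : {rmorphism B -> ring_quot (heitmann s)} := quot_map (heitmann s).
have [||x x_gen] := IHn (ring_quot (heitmann s)) (pi \o phi) b _ _ (dimB s).
- by exists (pi v); rewrite /= -rmorphM av1 rmorph1.
- move=> q; have [z ->] := quot_map_surj _ q.
  have [k [y zy]] := denom z; exists k, y.
  by rewrite /= -zy rmorphM rmorphXn.
pose t := [tuple phi (tnth b i + a * tnth x i) | i < n].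
(* The ideal generated by the moved entries in the quotient. *)
pose K' := [set q | exists2 z, ideal_gen t z & q = pi z]%classic.
have [g0 gD gM] := ideal_gen_ideal t.
have idK' : is_ideal K'.
  split.
  - by exists 0; rewrite ?rmorph0.
  - move=> _ _ [z tz ->] [w tw ->]; exists (z + w); rewrite ?rmorphD //.
    exact: gD.
  - move=> q _ [z tz ->]; have [w ->] := quot_map_surj _ q.
    by exists (w * z); rewrite ?rmorphM //; apply: gM.
have [|z tz] := x_gen _ idK'.
  move=> i; exists (tnth t i); last by rewrite tnth_mktuple.
  exact/mem_ideal_gen/mem_tnth.
rewrite -(rmorph1 pi) => /quot_map_eq[c [y [Jys z1]]].
have [k [d yd]] := denom y.
(* Here y is the p of the outline, and phi a ^+ k.+1 * y = phi (a * d). *)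
exists (cons_tuple d x) => K idK Kx.
have Kz : K z.
  apply: ideal_gen_min idK _ tz => w /tnthP[i ->].
  rewrite tnth_mktuple; have := Kx (lift ord0 i).
  by rewrite !tnthS.
have Kp : K (s + phi a * phi d).
  by have := Kx ord0; rewrite !tnth0 rmorphD rmorphM.
have v_a : v ^+ k.+1 * phi a ^+ k.+1 = 1.
  by rewrite -exprMn mulrC av1 expr1n.
have p_y : phi a * phi d = phi a ^+ k.+1 * y by rewrite -yd !exprS; ring.
apply: (ideal1_jacobson c (v ^+ k.+1) idK _ Kp).
  have [_ _ JM] := jacobson_ideal B.
  have -> : s * (phi a * phi d) = phi a ^+ k.+1 * (y * s) by rewrite p_y; ring.
  exact: JM.
have -> : s * c + phi a * phi d * v ^+ k.+1 = 1 - z.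
  by rewrite p_y z1 mulrAC [_ * v ^+ _]mulrC v_a mul1r.
by rewrite opprB addrC subrK.
Qed.

(** After the entries of [b] have been moved so as to generate the unit ideal
    of the localization at [a], some power of [a] lies in the ideal that they
    generate in [A]. *)
Lemma D_translate {n : nat} {A : comPzRingType} (a : A) (b : n.-tuple A) :
    Hdim_lt n (loc a) ->
  exists x : n.-tuple A,
    D (a :: b) = D [tuple tnth b i + a * tnth x i | i < n].
Proof.
move=> dimA; pose phi : {rmorphism A -> loc a} := loc_map a.
have [x x_gen] := unimodular_translate phi a b (loc_map_invertible a)
  (loc_map_clear_denom a) dimA.
exists x; set t := mktuple _.
have [g0 gD gM] := ideal_gen_ideal t.
(* The extension to the localization of the ideal generated by t. *)
pose K := [set z | exists m c, ideal_gen t c /\ phi a ^+ m * z = phi c]%classic.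
have idK : is_ideal K.
  split.
  - by exists 0%N, 0; rewrite mulr0 rmorph0.
  - move=> z w [m [c [tc zc]]] [l [d [td wd]]].
    exists (m + l)%N, (a ^+ l * c + a ^+ m * d).
    split; first by apply: (gD); apply: gM.
    by rewrite rmorphD !rmorphM !rmorphXn -zc -wd exprD; ring.
  - move=> w z [m [c [tc zc]]].
    have [l [d wd]] : exists l d, phi a ^+ l * w = phi d.
      exact: loc_map_clear_denom.
    exists (l + m)%N, (d * c); split; first exact: gM.
    by rewrite rmorphM -zc -wd exprD; ring.
have Da : D t a.
  have [|m [c [tc]]] := x_gen K idK.
    move=> i; exists 0%N, (tnth t i).
    by split; [apply/mem_ideal_gen/mem_tnth | rewrite mul1r tnth_mktuple].
  rewrite mulr1 -rmorphXn => /(loc_map_eq a)[l ac].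
  by exists (l + m)%N; rewrite exprD ac; apply: gM.
have [_ DtD DtM] := D_ideal t.
have [_ DD DM] := D_ideal (a :: b).
apply: D_eq => z.
- rewrite inE => /orP[/eqP -> // | /tnthP[i ->]].
  have -> : tnth b i = tnth t i + (- tnth x i) * a.
    by rewrite tnth_mktuple; ring.
  by apply: (DtD); [apply/mem_D/mem_tnth | apply: DtM].
- move=> /tnthP[i ->]; rewrite tnth_mktuple mulrC; apply: (DD).
    by apply: mem_D; rewrite inE mem_tnth orbT.
  by apply/(DM)/mem_D; rewrite inE eqxx.
Qed.

(** * Absorbing several elements *)

Lemma ideal_gen_cons {B : comPzRingType} (s : seq B) (c d z : B) :
  ideal_gen s z -> ideal_gen (c :: s) (c * d + z).
Proof.
have [_ gD gM] := ideal_gen_ideal (c :: s).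
move=> sz; apply: (gD).
  by rewrite mulrC; apply/gM/mem_ideal_gen; rewrite inE eqxx.
apply: ideal_gen_min sz; first exact: ideal_gen_ideal.
by move=> w sw; apply: mem_ideal_gen; rewrite inE sw orbT.
Qed.

Lemma D_cat_eq {B : comPzRingType} {s t : seq B} (r : seq B) :
  D s = D t -> D (r ++ s) = D (r ++ t).
Proof.
suff le u w : D u = D w -> forall z, z \in r ++ u -> D (r ++ w) z.
  by move=> st; apply: D_eq; apply: le.
move=> uw z; rewrite mem_cat => /orP[rz | /mem_D].
  by apply: mem_D; rewrite mem_cat rz.
rewrite uw; apply: D_le => y wy.
by apply: mem_D; rewrite mem_cat wy orbT.
Qed.

Lemma D_perm {B : comPzRingType} (s t : seq B) : s =i t -> D s = D t.
Proof. by move=> st; apply: D_eq => z zs; apply: mem_D; rewrite ?st // -st. Qed.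

Theorem mainTheorem5 (A : comPzRingType) (n : nat) :
  (forall (a : A) (b : n.-tuple A),
     Hdim_lt n (loc a) ->
     exists x : n.-tuple A,
       D (a :: b) = D [tuple tnth b i + a * tnth x i | i < n])
  /\
  (forall (r : nat) (a : r.-tuple A) (b : n.-tuple A),
     (forall i : 'I_r, Hdim_lt n (loc (tnth a i))) ->
     exists y : n.-tuple A,
       (forall i : 'I_n, ideal_gen a (tnth y i)) /\
       D (a ++ b) = D [tuple tnth b i + tnth y i | i < n]).
Proof.
split=> [a b | r]; first exact: D_translate.
elim: r => [|r IHr] a b dimA.
  exists [tuple 0 | i < n]; split=> [i|].
    by rewrite tnth_mktuple; have [] := ideal_gen_ideal a.
  rewrite (tuple0 a) cat0s; congr (D (tval _)).
  by apply: eq_from_tnth => i; rewrite !tnth_mktuple addr0.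
case/tupleP: a dimA => a0 a dimA.
have [x b_x] := D_translate a0 b (dimA ord0).
have [i|y [ay b_y]] := IHr a [tuple tnth b i + a0 * tnth x i | i < n].
  by have := dimA (lift ord0 i); rewrite tnthS.
exists [tuple a0 * tnth x i + tnth y i | i < n]; split=> [i|].
  by rewrite tnth_mktuple; apply: ideal_gen_cons.
have -> : [tuple tnth b i + tnth [tuple a0 * tnth x j + tnth y j | j < n] i
            | i < n] =
    [tuple tnth [tuple tnth b j + a0 * tnth x j | j < n] i + tnth y i | i < n].
  by apply: eq_from_tnth => i; rewrite !tnth_mktuple addrA.
rewrite -b_y -(D_cat_eq a b_x); apply: D_perm => z.
by rewrite /= !(inE, mem_cat) orbCA.
Qed.
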